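(* Let $0<\bar\varepsilon<1$ and let $E=\{u\in L^\infty((0,1)):u(x)=0\text{ for a.e. }x\in(0,\bar\varepsilon)\cup(1-\bar\varepsilon,1)\}$. Define $G:L^\infty((0,1))\to[0,+\infty]$ by $G(u)=|Du|((0,1))$ if $u\in BV((0,1))\cap E$ and $G(u)=+\infty$ otherwise, and let $B=\{u\in L^\infty((0,1)):G(u)\le1\}$. Then the set of extreme points of $B$ is $$\mathrm{Ext}(B)=\Big\{\sigma\tfrac12\mathbf 1_{[a,b]}:a,b\in[\bar\varepsilon,1-\bar\varepsilon],\ a<b\text{ and }\sigma\in\{-1,1\}\Big\}.$$
   Context: $|Du|((0,1))=\sup\{\int_0^1 u(x)\varphi'(x)\,dx:\varphi\in C_c^1((0,1)),\ \|\varphi\|_\infty\le1\}$ is the BV-seminorm of $u$, i.e. the total variation on $(0,1)$ of the distributional derivative of $u$. $\mathbf 1_{[a,b]}$ is the indicator function of $[a,b]$, equal to $1$ on $[a,b]$ and $0$ elsewhere, regarded as an element of $L^\infty((0,1))$. An element $u\in B$ is an extreme point of $B$ if $u=(1-s)u_1+su_2$ with $u_1,u_2\in B$ and $s\in(0,1)$ implies $u_1=u_2=u$; $\mathrm{Ext}(B)$ is the set of all extreme points of $B$.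
   Formalization: The formal theorem assumes ε̄ < 1/2 instead of ε̄ < 1: for 1/2 ≤ ε̄ < 1 one has E = {0}, so B = {0} and Ext(B) = {0}, while the right-hand set is empty, and the claimed equality fails. *)

(* Defs.v *)
From HB Require Import structures.
From mathcomp Require Import all_boot all_order all_algebra.
From mathcomp Require Import all_classical all_reals all_analysis.
From mathcomp Require Import ess_sup_inf measurable_realfun.
Set Implicit Arguments.
Unset Strict Implicit.
Unset Printing Implicit Defensive.
Import Order.TTheory GRing.Theory Num.Theory.
Import numFieldNormedType.Exports.
Local Open Scope classical_set_scope.
Local Open Scope ring_scope.
Definition extreme_points (R : realType) (V : lmodType R) (B : set V) : set V :=
  [set u | B u /\ forall (u1 u2 : V) (s : R), B u1 -> B u2 -> 0 < s < 1 ->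
     u = (1 - s) *: u1 + s *: u2 -> u1 = u /\ u2 = u].

(* Lebesgue measure on (0,1), as a measure on the whole line: two functions are
   a.e. equal for it iff they agree a.e. on (0,1), and a function on (0,1) is
   represented by any of its measurable extensions to R. *)
Definition leb01 (R : realType) :
    {measure set (measurableTypeR R) -> \bar R} :=
  mrestr (@lebesgue_measure R)
    (measurable_itv `]0, 1[ : measurable (`]0%R, 1%R[ : set R)).

(* [LspaceType] has no module structure in the library; it is given below. *)
Definition Linf01 (R : realType) : Type := LspaceType (leb01 R) (leey 1).

Definition Linf01_fun (R : realType) (u : Linf01 R) : R -> R :=
  (u : {mfun_ leb01 R, measurableTypeR R >-> measurableTypeR R}).
Coercion Linf01_fun : Linf01 >-> Funclass.

Section Linf01_class.
Context (R : realType).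
Local Notation T := (measurableTypeR R).
Local Notation mu := (leb01 R).
Local Notation Lfn := (LfunType mu (leey 1)).
Local Notation Mq := {mfun_ mu, T >-> measurableTypeR R}.
Implicit Types (f g : Lfn) (u v : Linf01 R).

Definition Linf01_mfun f : {mfun T >-> measurableTypeR R} :=
  @mfun_Sub _ _ T (measurableTypeR R) f
    (mem_set (@measurable_funPT _ _ T R f : measurable_fun setT (f : T -> T))).

Definition Linf01_quot f : Mq := \pi_Mq%qT (Linf01_mfun f).

Lemma Linf01_quot_ae f : ae_eq mu setT (Linf01_quot f : R -> R) (f : R -> R).
Proof.
have /asboolP h : ae_eq_op mu (repr (Linf01_quot f)) (Linf01_mfun f).
  by rewrite -eqmodE reprK.
exact: h.
Qed.

Lemma Linf01_quot_finite f : finite_norm mu +oo%E (Linf01_quot f : R -> R).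
Proof.
rewrite /finite_norm (_ : Lnorm _ _ _ = 'N[mu]_+oo[EFin \o f])%E.
  exact: Lfunction_finite.
rewrite unlock; case: ifPn => // _.
apply: eq_ess_sup; apply: filterS (Linf01_quot_ae f) => x h /=.
by rewrite h.
Qed.

Definition Linf01_class f : Linf01 R :=
  @LebesgueSpace.Pack _ _ _ mu _ (leey 1) (Linf01_quot f)
    (LebesgueSpace.Class
      (isFinLebesgue.Build _ T R mu _ (leey 1) (Linf01_quot f)
        (Linf01_quot_finite f))).

Lemma Linf01_class_ae f : ae_eq mu setT (Linf01_class f) f.
Proof. exact: Linf01_quot_ae. Qed.

Lemma Linf01_eqP u v : u = v <-> ae_eq mu setT u v.
Proof.
split=> [->|]; first exact: ae_eq_refl.
case: u v => [u [[pu]]] [v [[pv]]] uv.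
have e : u = v.
  rewrite -[u]reprK -[v]reprK; apply/eqP; rewrite eqmodE; apply/asboolP.
  exact: uv.
by move: pu uv; rewrite e => pu _; congr LebesgueSpace.Pack; rewrite (Prop_irrelevance pu pv).
Qed.

Lemma Linf01_memLfun u : (u : R -> R) \in @Lfun _ T R mu +oo%E.
Proof.
rewrite inE; apply/andP; split; rewrite inE.
  exact: (@measurable_funPT _ _ T T (repr (LebesgueSpace.sort u))).
exact: (@Lebesgue_finite _ _ _ _ _ _ u).
Qed.

Definition Linf01_lift u : Lfn := Lfun_Sub (leey 1) (Linf01_memLfun u).

End Linf01_class.

Section Linf01_lmodule.
Context (R : realType).
Local Notation mu := (leb01 R).
Implicit Types (u v w : Linf01 R) (a b : R).
Local Notation cls := (@Linf01_class R).
Local Notation lft := (@Linf01_lift R).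

Let zeroL : Linf01 R := cls 0.
Let oppL u := cls (- lft u).
Let addL u v := cls (lft u + lft v).
Let scaleL a u := cls (a *: lft u).

Let oppLE u : ae_eq mu setT (oppL u) (fun x => - u x).
Proof. exact: Linf01_class_ae. Qed.
Let addLE u v : ae_eq mu setT (addL u v) (fun x => u x + v x).
Proof. exact: Linf01_class_ae. Qed.
Let scaleLE a u : ae_eq mu setT (scaleL a u) (fun x => a * u x).
Proof. exact: Linf01_class_ae. Qed.
Let zeroLE : ae_eq mu setT zeroL (fun=> 0).
Proof. exact: Linf01_class_ae. Qed.

Let eqL u v (P : R -> Prop) : {ae mu, forall x, P x} ->
  (forall x, P x -> u x = v x) -> u = v.
Proof.
move=> hP PE; apply/Linf01_eqP.
by apply: (@filterS _ _ (ae_filter_ringOfSetsType mu) P) => // x /PE.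
Qed.

Let aeI (P Q : R -> Prop) : {ae mu, forall x, P x} ->
  {ae mu, forall x, Q x} -> {ae mu, forall x, P x /\ Q x}.
Proof. exact: (@filterI _ _ (ae_filter_ringOfSetsType mu)). Qed.

Let addLA : associative addL.
Proof.
move=> u v w; apply: (eqL (aeI (addLE u (addL v w)) (aeI (addLE v w)
  (aeI (addLE (addL u v) w) (addLE u v))))) => x [h1 [h2 [h3 h4]]].
by rewrite h1// h2// h3// h4// addrA.
Qed.

Let addLC : commutative addL.
Proof.
move=> u v; apply: (eqL (aeI (addLE u v) (addLE v u))) => x [h1 h2].
by rewrite h1// h2// addrC.
Qed.

Let add0L : left_id zeroL addL.
Proof.
move=> u; apply: (eqL (aeI (addLE zeroL u) zeroLE)) => x [h1 h2].
by rewrite h1// h2// add0r.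
Qed.

Let addNL : left_inverse zeroL oppL addL.
Proof.
move=> u; apply: (eqL (aeI (addLE (oppL u) u) (aeI (oppLE u) zeroLE))).
by move=> x [h1 [h2 h3]]; rewrite h1// h2// h3// addNr.
Qed.

HB.instance Definition _ := gen_eqMixin (Linf01 R).
HB.instance Definition _ := gen_choiceMixin (Linf01 R).
HB.instance Definition _ :=
  GRing.isZmodule.Build (Linf01 R) addLA addLC add0L addNL.

Let scaleLA a b u : scaleL a (scaleL b u) = scaleL (a * b) u.
Proof.
apply: (eqL (aeI (scaleLE a (scaleL b u)) (aeI (scaleLE b u)
  (scaleLE (a * b) u)))) => x [h1 [h2 h3]].
by rewrite h1// h2// h3// mulrA.
Qed.

Let scale1L : left_id 1 scaleL.
Proof. by move=> u; apply: (eqL (scaleLE 1 u)) => x h; rewrite h// mul1r. Qed.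

Let scaleLDr : right_distributive scaleL +%R.
Proof.
move=> a u v; apply: (eqL (aeI (scaleLE a (u + v)) (aeI (addLE u v)
  (aeI (addLE (scaleL a u) (scaleL a v)) (aeI (scaleLE a u)
  (scaleLE a v)))))) => x [h1 [h2 [h3 [h4 h5]]]].
by rewrite h1// h2// h3// h4// h5// mulrDr.
Qed.

Let scaleLDl u : {morph scaleL^~ u : a b / a + b}.
Proof.
move=> a b; apply: (eqL (aeI (scaleLE (a + b) u)
  (aeI (addLE (scaleL a u) (scaleL b u)) (aeI (scaleLE a u)
  (scaleLE b u))))) => x [h1 [h2 [h3 h4]]].
by rewrite h1// h2// h3// h4// mulrDl.
Qed.

HB.instance Definition _ := GRing.Zmodule_isLmodule.Build R (Linf01 R)
  scaleLA scale1L scaleLDr scaleLDl.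

Lemma Linf01_addE u v : ae_eq mu setT (u + v) (fun x => u x + v x).
Proof. exact: addLE. Qed.

Lemma Linf01_scaleE a u : ae_eq mu setT (a *: u) (fun x => a * u x).
Proof. exact: scaleLE. Qed.

End Linf01_lmodule.

Section indicator.
Context (R : realType).
Local Notation T := (measurableTypeR R).

Lemma indic_itv_memLfun (a b : R) :
  (\1_(`[a, b]) : R -> R) \in @Lfun _ T R (leb01 R) +oo%E.
Proof.
rewrite inE; apply/andP; split; rewrite inE/=.
  exact: measurable_indic.
rewrite /finite_norm unlock; case: ifPn => // mu0.
apply: (@le_lt_trans _ _ 1%E); last exact: ltry.
apply: ereal_inf_lbound; apply/nearW => x /=.
by rewrite lee_fin indicE ger0_norm// lern1 leq_b1.
Qed.

Definition Linf01_indic (a b : R) : Linf01 R :=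
  Linf01_class (Lfun_Sub (leey 1) (indic_itv_memLfun a b)).

End indicator.

(* C^1_c((0,1)): a test function on (0,1) is identified with its extension by
   zero, which is C^1 on the whole line. *)
Definition Cc1_01 (R : realType) : set (R -> R) :=
  [set phi : R -> R |
     [/\ forall x : R, derivable phi x 1,
         continuous (derive1 phi),
         compact (closure [set x | phi x != 0]) &
         closure [set x | phi x != 0] `<=` `]0, 1[]].

(* |Du|((0,1)); it only depends on the a.e. class of u on (0,1). *)
Definition total_variation01 (R : realType) (u : R -> R) : \bar R :=
  ereal_sup
    [set (\int[@lebesgue_measure R]_(x in `]0%R, 1%R[)
            (u x * derive1 (phi : R -> R) x)%:E)%E
    | phi in [set phi | @Cc1_01 R phi /\ forall x, `|phi x| <= 1]].

Definition BV01 (R : realType) : set (Linf01 R) :=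
  [set u | (@lebesgue_measure R).-integrable `]0%R, 1%R[ (EFin \o u) /\
     (total_variation01 u < +oo)%E].

Definition vanishing_near_boundary (R : realType) (e : R) : set (Linf01 R) :=
  [set u | {ae @lebesgue_measure R,
     forall x, (`]0, e[ `|` `](1 - e), 1[) x -> (u : R -> R) x = 0}].

Definition G01 (R : realType) (e : R) (u : Linf01 R) : \bar R :=
  if `[< (@BV01 R `&` vanishing_near_boundary e) u >] then total_variation01 u
  else +oo%E.

Definition ball_G01 (R : realType) (e : R) : set (Linf01 R) :=
  [set u | (G01 e u <= 1)%E].

(* Main.v *)
Require Import Defs.
From mathcomp Require Import all_boot all_order all_algebra.
From mathcomp Require Import all_classical all_reals all_analysis.
From mathcomp Require Import measurable_realfun lra.
Set Implicit Arguments.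
Unset Strict Implicit.
Unset Printing Implicit Defensive.
Import Order.TTheory GRing.Theory Num.Theory.
Import numFieldNormedType.Exports.
Local Open Scope classical_set_scope.
Local Open Scope ring_scope.

(** The unit ball of G is the set of differences of two monotone transitions,
    and its extreme points are read off from that description.

    Call transition a nondecreasing function which is 0 before e and 1/2 after
    1 - e. If u vanishes near the boundary and |Du|((0,1)) <= 1, then Du has
    total mass 0, hence its positive and negative parts both have mass at most
    1/2, and up to a common jump at 1 - e their distribution functions p and n
    are transitions with u = p - n ([unit_variation_jordan]). No measure Du has
    to be built: the mass of the negative part of Du on (0,x) is the supremum of
    the integrals of u phi' over the cutoffs phi with values in [0,1] and
    support inside (0,x) ([neg_variation]), and that of the positive part is the
    same supremum for - u. Their sum is at most 1 because a difference of two
    cutoffs is a test function bounded by 1, and their difference is u(x) at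
    every Lebesgue point x, because a cutoff can be replaced by its difference
    with a plateau that drops from 1 to 0 just before x
    ([neg_variation_jump]).

    Conversely p - n lies in the ball: a transition pairs with phi' to at most
    1/2 when |phi| <= 1 ([pairing_transition]), as it is a uniform limit of
    averages of finitely many indicators of half-lines, each scaled by 1/2.

    Let u = p - n be extreme. A transition p is the midpoint of the two
    transitions min(2 p, 1/2) and max(2 p - 1/2, 0), so extremality forces
    p = min(2 p, 1/2), that is, p takes only the values 0 and 1/2. It is then a
    single jump, at a point a of [e, 1 - e]; likewise n is a single jump at some
    b. So u is the half indicator of [a, b], or its opposite if b < a; and
    a = b is excluded because 0 is a midpoint of two opposite elements of the
    ball ([extreme_is_half_indic]).

    Let finally u be the half indicator of [a, b], a convex combination of
    p1 - n1 and p2 - n2, and let P and N be the same combinations of p1, p2 and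
    of n1, n2. These are transitions with P - N = 1/2 on (a, b), so P = 1/2 and
    N = 0 there; monotonicity spreads this to P = 1/2 after a and N = 0 before
    b, and the equation determines P and N on the remaining sides. All the
    values are extremal in [0, 1/2], so p1 = p2 = P and n1 = n2 = N
    ([conv_jumps_unique], [half_indic_extreme]). *)

(** * Operations on almost everywhere statements *)

Section almost_everywhere_filter.
Context d (T : ringOfSetsType d) (R : realFieldType)
  (mu : {measure set T -> \bar R}).

Lemma ae_imp (P Q : T -> Prop) : (forall x, P x -> Q x) ->
  {ae mu, forall x, P x} -> {ae mu, forall x, Q x}.
Proof. exact: (@filterS _ _ (ae_filter_ringOfSetsType mu)). Qed.

Lemma ae_and (P Q : T -> Prop) : {ae mu, forall x, P x} ->
  {ae mu, forall x, Q x} -> {ae mu, forall x, P x /\ Q x}.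
Proof. exact: (@filterI _ _ (ae_filter_ringOfSetsType mu)). Qed.

End almost_everywhere_filter.

Section real_functions.
Context {R : realType}.
Implicit Types (phi psi u v p n q : R -> R) (x y a b c d e t : R).
Local Notation mu := (@lebesgue_measure R).
Local Notation integrable01 u := (mu.-integrable `]0, 1[ (EFin \o u)).

(** * Pairing of a function with the derivative of a test function *)

Definition C1 phi := (forall x, derivable phi x 1) /\ continuous (derive1 phi).

Lemma C1_derive1D phi psi : C1 phi -> C1 psi ->
  derive1 (phi \+ psi) = derive1 phi \+ derive1 psi.
Proof.
move=> [dphi _] [dpsi _]; apply/funext => x /=.
by rewrite !derive1E; exact: deriveD.
Qed.

Lemma C1_derive1N phi : C1 phi -> derive1 (\- phi) = \- derive1 phi.
Proof.
by move=> [dphi _]; apply/funext => x /=; rewrite !derive1E; exact: deriveN.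
Qed.

Lemma C1D phi psi : C1 phi -> C1 psi -> C1 (phi \+ psi).
Proof.
move=> cphi cpsi; split=> [x|]; first exact: derivableD (cphi.1 x) (cpsi.1 x).
rewrite C1_derive1D// => x; exact: continuousD (cphi.2 x) (cpsi.2 x).
Qed.

Lemma C1N phi : C1 phi -> C1 (\- phi).
Proof.
move=> cphi; split=> [x|]; first exact: derivableN (cphi.1 x).
by rewrite C1_derive1N// => x; exact: continuousN (cphi.2 x).
Qed.

Lemma C1B phi psi : C1 phi -> C1 psi -> C1 (phi \- psi).
Proof. by move=> cphi /C1N; exact: C1D. Qed.

Lemma C1_0 : C1 (cst 0 : R -> R).
Proof.
split=> [x|]; first exact: derivable_cst.
have -> : derive1 (cst 0 : R -> R) = cst 0 by apply/funext => x; exact: derive1_cst.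
by move=> x; exact: cvg_cst.
Qed.

Lemma continuous_bounded01 (g : R -> R) : continuous g ->
  exists M, forall x, x \in `[0, 1] -> `|g x| <= M.
Proof.
move=> cg.
have /compact_bounded[M [_ HM]] : compact (g @` `[0, 1]).
  apply: continuous_compact; last exact: segment_compact.
  exact: continuous_subspaceT.
exists (M + 1) => x x01; apply: (HM (M + 1)); first by rewrite ltrDl.
by exists x.
Qed.

Lemma integrable01_bounded u M : measurable_fun setT u ->
  (forall x, `|u x| <= M) -> integrable01 u.
Proof.
move=> mu_ uM; apply: measurable_bounded_integrable => //.
- by rewrite /= lebesgue_measure_itv/= lte_fin ltr01 -EFinD ltry.
- exact: measurable_funTS.
- by exists M; split; rewrite ?num_real// => K MK y _; exact: le_trans (ltW MK).
Qed.

Lemma integrable01_cst a : integrable01 (cst a).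
Proof. by apply: (@integrable01_bounded _ `|a|). Qed.

Lemma integrable01M u (g : R -> R) :
  integrable01 u -> continuous g ->
  integrable01 (fun x => u x * g x).
Proof.
move=> iu cg; have [M HM] := continuous_bounded01 cg.
apply: (@integrableMl _ _ _ mu _ _ (EFin \o u) g) => //.
  apply: measurable_funS (measurableT) _ _ => //.
  exact: continuous_measurable_fun.
exists M; split; rewrite ?num_real// => K MK x /= x01.
by apply: le_trans (ltW MK); apply: HM; apply: subset_itv_oo_cc.
Qed.

Lemma integrable01N u : integrable01 u ->
  integrable01 (\- u).
Proof. by move=> iu; exact: (integrableN iu). Qed.

Definition pairing u phi := (\int[mu]_(x in `]0%R, 1%R[) (u x * derive1 phi x))%R.

Lemma pairingD u phi psi : integrable01 u ->
  C1 phi -> C1 psi -> pairing u (phi \+ psi) = pairing u phi + pairing u psi.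
Proof.
move=> iu cphi cpsi; rewrite /pairing C1_derive1D//.
rewrite -RintegralD//; [|exact: integrable01M cphi.2|exact: integrable01M cpsi.2].
by apply: eq_Rintegral => x _ /=; rewrite mulrDr.
Qed.

Lemma pairingN u phi : integrable01 u ->
  C1 phi -> pairing u (\- phi) = - pairing u phi.
Proof.
move=> iu cphi; rewrite /pairing C1_derive1N// -mulN1r -RintegralZl//.
  by apply: eq_Rintegral => x _ /=; rewrite mulrN mulN1r.
exact: integrable01M cphi.2.
Qed.

Lemma pairingB u phi psi : integrable01 u ->
  C1 phi -> C1 psi -> pairing u (phi \- psi) = pairing u phi - pairing u psi.
Proof.
by move=> iu cphi cpsi; rewrite (pairingD iu cphi (C1N cpsi)) (pairingN iu cpsi).
Qed.

Lemma pairingDl u v phi : integrable01 u -> integrable01 v -> C1 phi ->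
  pairing (u \+ v) phi = pairing u phi + pairing v phi.
Proof.
move=> iu iv cphi; rewrite /pairing -RintegralD//; last 2 first.
  exact: integrable01M iu cphi.2.
  exact: integrable01M iv cphi.2.
by apply: eq_Rintegral => x _ /=; rewrite mulrDl.
Qed.

Lemma pairingNl u phi : integrable01 u ->
  C1 phi -> pairing (\- u) phi = - pairing u phi.
Proof.
move=> iu cphi; rewrite -(pairingN iu cphi) /pairing (C1_derive1N cphi).
by apply: eq_Rintegral => x _ /=; rewrite mulrN mulNr.
Qed.

Lemma pairing0 u : pairing u (cst 0) = 0.
Proof.
rewrite /pairing (@eq_Rintegral _ _ _ mu _ (cst 0)); last first.
  by move=> x _ /=; rewrite derive1_cst mulr0.
by rewrite Rintegral_cst// mul0r.
Qed.

(** A support condition with explicit bounds is easier to propagate through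
    sums than the compactness of a closure. *)
Lemma supported_Cc1_01 phi (a b : R) : C1 phi -> 0 < a -> b < 1 ->
  (forall x, phi x != 0 -> a <= x <= b) -> Cc1_01 phi.
Proof.
move=> cphi a0 b1 sphi; have cl : closure [set x | phi x != 0] `<=` `[a, b].
  have /closure_id -> : closed (`[a, b] : set R) by exact: interval_closed.
  by apply: closureS => x /= /sphi; rewrite in_itv.
split; [exact: cphi.1|exact: cphi.2| |].
  apply: (subclosed_compact _ (@segment_compact _ a b) cl).
  exact: closed_closure.
apply: subset_trans cl _ => x /=; rewrite !in_itv/= => /andP[ax xb].
by rewrite (lt_le_trans a0 ax) (le_lt_trans xb b1).
Qed.

Lemma FTC_C1 phi a b : C1 phi -> a <= b ->
  (\int[mu]_(x in `]a, b[) derive1 phi x = phi b - phi a)%R.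
Proof.
move=> cphi; rewrite le_eqVlt => /predU1P[->|ab].
  by rewrite set_itvoo0 ?bnd_simp// Rintegral_set0 subrr.
rewrite /Rintegral.
have mphi : measurable_fun `]a, b[ (EFin \o derive1 phi).
  apply/measurable_EFinP; apply: measurable_funS (measurableT) _ _ => //.
  exact: continuous_measurable_fun cphi.2.
rewrite -(integral_itv_bndoo true false mphi).
rewrite (@continuous_FTC2 _ _ phi)//.
- exact: continuous_subspaceT cphi.2.
- have cont x : {for x, continuous phi}.
    by apply: differentiable_continuous; apply/derivable1_diffP; exact: cphi.1.
  split=> [x _||]; first exact: cphi.1.
    exact: cvg_at_right_filter (cont a).
  exact: cvg_at_left_filter (cont b).
Qed.

Lemma pairing_cst a phi : C1 phi ->
  pairing (cst a) phi = a * (phi 1 - phi 0).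
Proof.
move=> cphi; rewrite /pairing -(FTC_C1 cphi ler01) -RintegralZl//.
have := integrable01M (integrable01_cst 1) cphi.2.
by under [X in EFin \o X]eq_fun do rewrite mul1r.
Qed.

Lemma derive1_near0 phi x : (\forall y \near x, phi y = 0) -> derive1 phi x = 0.
Proof.
move=> nphi; have -> : derive1 phi x = derive1 (cst (0 : R)) x.
  rewrite !derive1E; apply: near_eq_derive.
  by near=> y; rewrite /cst; near: y.
exact: derive1_cst.
Unshelve. all: by end_near. Qed.

(** * Ramps: continuously differentiable transitions from 0 to 1 *)

Definition posq t : R := (Num.max t 0) ^+ 2.

(** Since the second derivative of [posq] lies between 0 and 2, the Taylor
    remainder is at most the square of the increment; this handles the corner at
    0 together with the other points. *)
Lemma posq_taylor t h : `|posq (t + h) - posq t - 2 * Num.max t 0 * h| <= h ^+ 2.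
Proof.
rewrite /posq ler_norml.
by case: (leP t 0) => t0; case: (leP (t + h) 0) => th0; apply/andP; split; nra.
Qed.

Lemma is_derive_posq t : is_derive t 1 posq (2 * Num.max t 0).
Proof.
have H : (fun h => h^-1 *: ((posq \o shift t) (h *: 1) - posq t)) @ 0^' -->
    2 * Num.max t 0.
  apply/cvgrPdist_le => /= e e0; near=> h.
  have h0 : h != 0 by near: h; exact: nbhs_dnbhs_neq.
  rewrite /= /shift /= [h%:A]mulr1 [h + t]addrC.
  have -> : 2 * Num.max t 0 - h^-1 *: (posq (t + h) - posq t) =
     - (h^-1 * (posq (t + h) - posq t - 2 * Num.max t 0 * h)).
    by rewrite [in RHS]mulrBr opprB [_ * _ * h]mulrC mulKf.
  rewrite normrN normrM normfV ler_pdivrMl ?normr_gt0//.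
  apply: le_trans (posq_taylor t h) _.
  rewrite -real_normK ?num_real// expr2 ler_wpM2l//.
  by near: h; apply: dnbhs0_le.
apply: DeriveDef; first by apply: cvgP H.
exact: cvg_lim H.
Unshelve. all: by end_near. Qed.

(** The integral of a tent function of height 2 on [0, 1]: a monotone function
    of class C1 going from 0 to 1, written with squares of positive parts. *)
Definition step t : R := 2 * (posq t - 2 * posq (t - 2^-1) + posq (t - 1)).
Definition dstep t : R :=
  4 * (Num.max t 0 - 2 * Num.max (t - 2^-1) 0 + Num.max (t - 1) 0).

Lemma derivable_affine_comp (f : R -> R) c d y :
  (forall t, derivable f t 1) -> derivable (fun y => f ((y - c) / d)) y 1.
Proof.
move=> df; apply/derivable1_diffP.
apply: (@differentiable_comp _ _ _ _ (fun y => (y - c) / d) f y).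
  by apply/derivable1_diffP.
exact/derivable1_diffP.
Qed.

Lemma derive1_affine_comp (f : R -> R) c d y :
  (forall t, derivable f t 1) ->
  derive1 (fun y => f ((y - c) / d)) y = derive1 f ((y - c) / d) / d.
Proof.
move=> df; rewrite (@derive1_comp _ (fun y => (y - c) / d) f y)//; congr (_ * _).
by rewrite derive1E derive_val//= scaler0 add0r subr0 [_%:A]mulr1.
Qed.

Lemma is_derive_step t : is_derive t 1 step (dstep t).
Proof.
have dp s : derivable posq s 1 by case: (is_derive_posq s).
have sh c : is_derive t 1 (fun t => posq (t - c)) (2 * Num.max (t - c) 0).
  have -> : (fun t => posq (t - c)) = fun t => posq ((t - c) / 1).
    by apply/funext => s; rewrite divr1.
  apply: DeriveDef; first exact: derivable_affine_comp.
  rewrite -derive1E derive1_affine_comp// !divr1 derive1E.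
  by case: (is_derive_posq (t - c)).
have dp0 := is_derive_posq t; have dp2 := sh 2^-1; have dp1 := sh 1.
have -> : step = 2 \*: (posq - 2 \*: (fun t => posq (t - 2^-1)) +
                        (fun t => posq (t - 1))) by [].
apply: is_derive_eq; rewrite /dstep /GRing.scale/=.
lra.
Qed.

Lemma C1_step : C1 step.
Proof.
split=> [x|]; first by case: (is_derive_step x).
have -> : derive1 step = dstep.
  by apply/funext => x; rewrite derive1E; case: (is_derive_step x).
have cm c : continuous (fun x : R => Num.max (x - c) 0).
  move=> x; apply: (@continuous_max _ _ (fun x => x - c) (cst 0)).
    by apply: cvgB; [exact: cvg_id|exact: cvg_cst].
  exact: cvg_cst.
have c0 : continuous (fun x : R => Num.max x 0).
  by have := cm 0; under eq_fun do rewrite subr0.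
move=> x; apply: cvgM; first exact: cvg_cst.
apply: cvgD; last exact: cm.
by apply: cvgB; [exact: c0|apply: cvgM; [exact: cvg_cst|exact: cm]].
Qed.

Lemma step_le0 t : t <= 0 -> step t = 0.
Proof.
by move=> t0; rewrite /step /posq !max_r; lra.
Qed.

Lemma step_ge1 t : 1 <= t -> step t = 1.
Proof.
by move=> t1; rewrite /step /posq !max_l; lra.
Qed.

Lemma step_itv t : 0 <= step t <= 1.
Proof.
rewrite /step /posq.
by apply/andP; split; case: (leP t 0) => ?; case: (leP (t - 2^-1) 0) => ?;
  case: (leP (t - 1) 0) => ?; nra.
Qed.

Lemma dstep_itv t : 0 <= dstep t <= 2.
Proof.
rewrite /dstep.
by apply/andP; split; case: (leP t 0) => ?; case: (leP (t - 2^-1) 0) => ?;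
  case: (leP (t - 1) 0) => ?; lra.
Qed.

Lemma dstep_eq0 t : (t <= 0) || (1 <= t) -> dstep t = 0.
Proof.
by rewrite /dstep => /orP[]?; case: (leP t 0) => ?;
  case: (leP (t - 2^-1) 0) => ?; case: (leP (t - 1) 0) => ?; lra.
Qed.

(** Goes from 0 at c to 1 at c + d. *)
Definition ramp c d y : R := step ((y - c) / d).

Lemma derive1_ramp c d y : derive1 (ramp c d) y = dstep ((y - c) / d) / d.
Proof.
rewrite derive1_affine_comp; last exact: C1_step.1.
by rewrite derive1E; case: (is_derive_step ((y - c) / d)) => _ ->.
Qed.

Lemma C1_ramp c d : C1 (ramp c d).
Proof.
split=> [x|]; first by apply: derivable_affine_comp; exact: C1_step.1.
have -> : derive1 (ramp c d) = fun y => derive1 step ((y - c) / d) / d.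
  apply/funext => y; rewrite derive1_affine_comp//; exact: C1_step.1.
move=> x; apply: cvgM; last exact: cvg_cst.
apply: (@continuous_comp _ _ _ (fun y => (y - c) / d) (derive1 step));
  last exact: C1_step.2.
apply: cvgM; last exact: cvg_cst.
by apply: cvgB; [exact: cvg_id|exact: cvg_cst].
Qed.

Lemma ramp_le c d y : 0 < d -> y <= c -> ramp c d y = 0.
Proof.
by move=> d0 yc; apply: step_le0; rewrite pmulr_lle0 ?invr_gt0// subr_le0.
Qed.

Lemma ramp_ge c d y : 0 < d -> c + d <= y -> ramp c d y = 1.
Proof.
by move=> d0 yc; apply: step_ge1; rewrite ler_pdivlMr// mul1r lerBrDl.
Qed.

Lemma ramp_itv c d y : 0 <= ramp c d y <= 1.
Proof. exact: step_itv. Qed.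

Lemma derive1_ramp_itv c d y : 0 < d -> 0 <= derive1 (ramp c d) y <= 2 / d.
Proof.
move=> d0; have /andP[l r] := dstep_itv ((y - c) / d).
by rewrite derive1_ramp divr_ge0 ?(ltW d0)//= ler_pM2r// invr_gt0.
Qed.

Lemma derive1_ramp_eq0 c d y : 0 < d -> (y <= c) || (c + d <= y) ->
  derive1 (ramp c d) y = 0.
Proof.
move=> d0 yc; rewrite derive1_ramp dstep_eq0 ?mul0r//.
rewrite pmulr_lle0 ?invr_gt0// subr_le0 ler_pdivlMr// mul1r.
by rewrite -(lerD2l c d) [c + (y - c)]addrC subrK in yc *.
Qed.

(** * Recovering a function at its Lebesgue points *)

Lemma lebesgue_pt01_ae u : integrable01 u ->
  {ae mu, forall x, lebesgue_pt (u \_ `]0, 1[) x}.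
Proof.
move=> iu; apply: lebesgue_differentiation.
apply: integrable_locally_restrict => //.
Qed.

Lemma pairing_ramp_ae0 u c d : integrable01 u -> 0 < d -> 0 <= c -> c + d <= 1 ->
  {ae mu, forall x, x \in `]c, c + d[ -> u x = 0} -> pairing u (ramp c d) = 0.
Proof.
move=> iu d0 c0 cd1 u0; rewrite /pairing /Rintegral.
rewrite (@ae_eq_integral _ _ _ mu `]0, 1[ (cst 0))//.
- by rewrite integral0.
- by have /measurable_int := integrable01M iu (C1_ramp c d).2.
apply: ae_imp u0 => x ux0 _ /=; congr EFin.
have [xc|xc] := leP x c; first by rewrite derive1_ramp_eq0 ?xc// mulr0.
have [xd|xd] := leP (c + d) x; first by rewrite derive1_ramp_eq0 ?xd ?orbT// mulr0.
by rewrite ux0 ?mul0r// in_itv/= xc xd.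
Qed.

Lemma near_right0 (P : R -> Prop) : (\forall d \near 0^'+, P d) ->
  exists2 d0, 0 < d0 & forall d, 0 < d < d0 -> P d.
Proof.
rewrite near_withinE => /nbhs_ballP[d0 /= d00 H]; exists d0 => // d /andP[d_gt0 dd0].
by apply: H => //=; rewrite /ball/= sub0r normrN gtr0_norm.
Qed.

(** The derivative of a ramp of width d is an averaging kernel of integral 1,
    bounded by 2 / d and carried by [x - 2 d, x - d], a subset of the ball of
    radius 2 d around x. So the error is at most 2 / d times the integral of
    |u - u(x)| over that ball, which is 8 times its mean value there. *)
Lemma pairing_ramp_lebesgue_pt u x eps : integrable01 u -> 0 < x < 1 ->
  lebesgue_pt (u \_ `]0, 1[) x -> 0 < eps ->
  exists2 d0, 0 < d0 & forall d, 0 < d < d0 ->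
    `|pairing u (ramp (x - 2 * d) d) - u x| <= eps.
Proof.
move=> iu /andP[x0 x1] + eps0.
set f := u \_ `]0, 1[ => lpt.
have e8 : 0 < eps / 8 by rewrite divr_gt0.
have [d1 d10 H1] : exists2 d1, 0 < d1 & forall r, 0 < r < d1 ->
    (davg f x r <= (eps / 8)%:E)%E.
  apply: near_right0; have /fine_cvgP[fin /cvgr_le/(_ _ e8) le8] := lpt.
  near=> r; rewrite -[leLHS]fineK ?lee_fin; first by near: r.
  by near: r.
pose d0 := Num.min d1 (Num.min x (1 - x)) / 2.
exists d0; first by rewrite divr_gt0// !lt_min d10 x0 subr_gt0.
move=> d /andP[d_gt0]; rewrite /d0 ltr_pdivlMr// mulrC !lt_min.
move=> /andP[d21 /andP[d2x d2x1]].
have ic := @integrable01_cst.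
have cr := C1_ramp (x - 2 * d) d.
have ux : pairing (cst (u x)) (ramp (x - 2 * d) d) = u x.
  rewrite pairing_cst// ramp_ge ?ramp_le ?subr0 ?mulr1//; lra.
have iuc : integrable01 (u \- cst (u x)).
  exact: (integrableB _ iu (ic (u x))).
have -> : pairing u (ramp (x - 2 * d) d) - u x =
    pairing (u \- cst (u x)) (ramp (x - 2 * d) d).
  rewrite -{1}ux /pairing -RintegralB//; last 2 first.
    exact: (integrable01M iu cr.2).
    exact: (integrable01M (ic _) cr.2).
  by apply: eq_Rintegral => y _ /=; rewrite mulrBl.
have i1 := integrable01M iuc cr.2.
(* from here on u - u(x) is estimated by its mean over the ball *)
rewrite -lee_fin (EFin_normr_Rintegral _ i1)//.
apply: le_trans (le_abse_integral _ _ _) _ => //.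
  by have /measurable_int := i1.
have ball01 y : ball x (2 * d) y -> 0 < y < 1.
  rewrite ball_itv/= in_itv/= => /andP[l r]; apply/andP; split; lra.
have fE y : ball x (2 * d) y -> f y = u y.
  by move=> /ball01 y01; rewrite /f patchE mem_set//= in_itv.
have fx : f x = u x by apply: fE; apply: ballxx; rewrite mulr_gt0.
pose g y := ((2 / d)%:E * `|((center (f x) \o f) y)%:E|)%E.
have mf : measurable_fun setT f.
  have [+ _ _] := integrable_locally_restrict (measurable_itv `]0, 1[) iu.
  exact.
have mcf : measurable_fun setT (fun y => `|((center (f x) \o f) y)%:E|%E).
  by apply: measurableT_comp => //; apply/measurable_EFinP; exact: measurable_funB.
have mg : measurable_fun setT g by apply: measurable_funeM.
apply: (@le_trans _ _ (\int[mu]_(y in `]0%R, 1%R[) (g \_ (ball x (2 * d))) y)%E).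
  apply: ge0_le_integral => //.
  - by apply: measurableT_comp => //; have /measurable_int := i1.
  - apply: measurable_funS (measurableT) _ _ => //.
    apply/measurable_restrict => //; first exact: measurable_ball.
    by rewrite setTI; exact: measurable_funTS.
  - move=> y _ /=; rewrite patchE; case: ifPn => [|yb].
      rewrite inE => yb; rewrite /g /= fx fE//.
      rewrite normrM mulrC lee_fin ler_wpM2r//.
      have /andP[r0 r2] := derive1_ramp_itv (x - 2 * d) y d_gt0.
      by rewrite ger0_norm.
    rewrite derive1_ramp_eq0// ?mulr0 ?normr0//.
    apply: contraNT yb => h; rewrite inE ball_itv/= in_itv/=.
    by move: h; rewrite negb_or -!ltNge => /andP[l r]; apply/andP; split; lra.
rewrite -integral_mkcondr (_ : _ `&` _ = ball x (2 * d)); last first.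
  by apply/seteqP; split => [y []//|y yb]; split => //=; rewrite in_itv/= ball01.
rewrite /g ge0_integralZl//; last 3 first.
- exact: measurable_ball.
- exact: measurable_funTS.
- by rewrite lee_fin divr_ge0// ltW.
have := H1 (2 * d); rewrite mulr_gt0// d21 => /(_ erefl).
rewrite /davg /iavg lebesgue_measure_ball; last by rewrite mulr_ge0// ltW.
have d4 : 0 < (2 * d) *+ 2 by rewrite mulrn_wgt0// mulr_gt0.
rewrite inver gt_eqF// lee_pdivrMl// => h.
apply: (@le_trans _ _ ((2 / d)%:E * ((2 * d) *+ 2 * (eps / 8))%:E)%E).
  by rewrite lee_pmul2l// lte_fin divr_gt0.
rewrite -EFinM lee_fin.
have -> : 2 / d * ((2 * d) *+ 2 * (eps / 8)) = (d^-1 * d) * eps by lra.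
by rewrite mulVf ?mul1r// gt_eqF.
Unshelve. all: by end_near. Qed.

(** * The negative variation defined by duality *)

(** With strict inequalities the support is compact in (0,x), which leaves room
    for a ramp before x. *)
Definition cutoffs x : set (R -> R) := [set phi | [/\ C1 phi,
  (exists a b, [/\ 0 < a, b < x & forall y, phi y != 0 -> a <= y <= b]) &
  forall y, 0 <= phi y <= 1]].

(** As the pairing of u with phi is minus the integral of phi against Du, this is
    the mass of the negative part of Du on (0,x); for - u it is the mass of the
    positive part. *)
Definition neg_variation u x := sup [set pairing u phi | phi in cutoffs x].

Definition unit_variation u :=
  forall phi, Cc1_01 phi -> (forall y, `|phi y| <= 1) -> pairing u phi <= 1.

Lemma cutoffs0 x : cutoffs x (cst 0).
Proof.
split; [exact: C1_0| |by move=> y; rewrite lexx ler01].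
exists 1, (x - 1); split=> [//||y]; first by rewrite gtrBl.
by rewrite eqxx.
Qed.

Lemma cutoffs_le x y : x <= y -> cutoffs x `<=` cutoffs y.
Proof.
move=> xy phi [cphi [a [b [a0 bx sphi]]] phi01]; split=> //.
by exists a, b; split=> //; exact: lt_le_trans xy.
Qed.

Lemma cutoffsB_Cc1_01 x y phi psi : x <= 1 -> y <= 1 ->
  cutoffs x phi -> cutoffs y psi ->
  Cc1_01 (phi \- psi) /\ forall z, `|(phi \- psi) z| <= 1.
Proof.
move=> x1 y1 [cphi [a [b [a0 bx sphi]]] phi01] [cpsi [c [d [c0 dy spsi]]] psi01].
split; last first.
  move=> z /=; have /andP[? ?] := phi01 z; have /andP[? ?] := psi01 z.
  by rewrite ler_norml; apply/andP; split; lra.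
apply: (@supported_Cc1_01 _ (Num.min a c) (Num.max b d)).
- exact: C1B.
- by rewrite lt_min a0.
- by rewrite gt_max (lt_le_trans bx x1) (lt_le_trans dy y1).
- move=> z /=; rewrite ge_min le_max.
  have [phi0|/sphi/andP[-> ->]//] := eqVneq (phi z) 0.
  have [psi0|/spsi/andP[-> ->]] := eqVneq (psi z) 0; last by rewrite !orbT.
  by rewrite phi0 psi0 subrr eqxx.
Qed.

Lemma unit_variationN u : integrable01 u -> unit_variation u ->
  unit_variation (\- u).
Proof.
move=> iu vu phi cphi phi1; have C1phi : C1 phi by case: cphi.
rewrite (pairingNl iu C1phi) -(pairingN iu C1phi); apply: vu; last first.
  by move=> y /=; rewrite normrN.
have E : [set x | (\- phi) x != 0] = [set x | phi x != 0].
  by apply/seteqP; split=> x /=; rewrite oppr_eq0.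
have [? ?] := C1N C1phi; case: cphi => _ _ c1 c2.
by split=> //; rewrite E.
Qed.

(** Cutoffs take values in [0,1], so the difference of two of them is still
    bounded by 1: this is what makes the two variations of u share a total mass
    of at most 1. *)
Lemma pairing_cutoffsB u x y phi psi : unit_variation u -> integrable01 u ->
  x <= 1 -> y <= 1 -> cutoffs x phi -> cutoffs y psi ->
  pairing u phi - pairing u psi <= 1.
Proof.
move=> vu iu x1 y1 cphi cpsi; rewrite -pairingB//; [|by case: cphi|by case: cpsi].
by have [? ?] := cutoffsB_Cc1_01 x1 y1 cphi cpsi; exact: vu.
Qed.

Lemma neg_variation_has_sup u x : unit_variation u -> integrable01 u -> x <= 1 ->
  has_sup [set pairing u phi | phi in cutoffs x].
Proof.
move=> vu iu x1; split.
  by exists (pairing u (cst 0)), (cst 0) => //; exact: cutoffs0.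
exists 1 => _ [phi cphi <-].
have := pairing_cutoffsB vu iu x1 x1 cphi (cutoffs0 x).
by rewrite pairing0 subr0.
Qed.

Lemma neg_variation_ge u x phi : unit_variation u -> integrable01 u -> x <= 1 ->
  cutoffs x phi -> pairing u phi <= neg_variation u x.
Proof.
move=> vu iu x1 cphi; apply: ub_le_sup; last by exists phi.
by have [] := neg_variation_has_sup vu iu x1.
Qed.

Lemma neg_variation_le u x M : 
  (forall phi, cutoffs x phi -> pairing u phi <= M) -> neg_variation u x <= M.
Proof.
move=> H; apply: ge_sup => [|_ [phi /H ? <-]//].
by exists (pairing u (cst 0)), (cst 0) => //; exact: cutoffs0.
Qed.

Lemma neg_variation_homo u x y : unit_variation u -> integrable01 u ->
  x <= y -> y <= 1 -> neg_variation u x <= neg_variation u y.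
Proof.
move=> vu iu xy y1; apply: neg_variation_le => phi /(cutoffs_le xy).
exact: neg_variation_ge.
Qed.

Lemma neg_variationD u x : unit_variation u -> integrable01 u -> x <= 1 ->
  neg_variation u x + neg_variation (\- u) x <= 1.
Proof.
move=> vu iu x1; rewrite -lerBrDr; apply: neg_variation_le => phi cphi.
rewrite lerBrDr -lerBrDl; apply: neg_variation_le => psi cpsi.
have C1psi : C1 psi by case: cpsi.
rewrite (pairingNl iu C1psi) lerBrDr addrC.
exact: (pairing_cutoffsB vu iu x1 x1 cphi cpsi).
Qed.

(** On (0,e) the function u vanishes, and beyond x the cutoffs do. *)
Lemma neg_variation_eq0 u x e : integrable01 u -> x <= e ->
  {ae mu, forall y, y \in `]0, e[ -> u y = 0} -> neg_variation u x = 0.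
Proof.
move=> iu xe u0; rewrite /neg_variation (_ : image _ _ = [set 0]) ?sup1//.
apply/seteqP; split=> [_ [phi [cphi [a [b [a0 bx sphi]]] _] <-]|_ ->] /=; last first.
  by exists (cst 0); [exact: cutoffs0|exact: pairing0].
rewrite /pairing /Rintegral (@ae_eq_integral _ _ _ mu `]0, 1[ (cst 0))//.
- by rewrite integral0.
- by have /measurable_int := integrable01M iu cphi.2.
apply: ae_imp u0 => y uy0 /=; rewrite in_itv/= => /andP[y0 y1]; congr EFin.
have [ye|ye] := ltP y e; first by rewrite uy0 ?mul0r// in_itv/= y0.
rewrite derive1_near0 ?mulr0//.
have : b < y by lra.
move=> by_; near=> z; apply/eqP; apply: contraT => /sphi /andP[_ zb].
suff : b < z by rewrite ltNge zb.
by near: z; exact: lt_nbhsr.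
Unshelve. all: by end_near. Qed.

(** Half of the identity Du((0,x)) = u(x). Given a cutoff phi, take a plateau eta
    which rises inside (0,e), where u vanishes, is 1 on the support of phi, and
    drops just before x. Then eta - phi is again a cutoff, and pairing it with
    - u gives the pairing of u with phi, plus almost u(x). The other half follows
    by exchanging u and - u. *)
Lemma neg_variation_jump u x e : unit_variation u -> integrable01 u ->
  0 < e -> e <= 1 -> {ae mu, forall y, y \in `]0, e[ -> u y = 0} ->
  0 < x < 1 -> lebesgue_pt (u \_ `]0, 1[) x ->
  neg_variation u x + u x <= neg_variation (\- u) x.
Proof.
move=> vu iu e0 e1 u0 x01 lpt; have /andP[x0 x1] := x01.
rewrite -lerBrDr; apply: neg_variation_le => phi cphi.
rewrite lerBrDr; apply/ler_addgt0Pr => eps eps0.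
have [d0 d00 Hd] := pairing_ramp_lebesgue_pt iu x01 lpt eps0.
have [C1phi [a [b [a0 bx sphi]]] phi01] := cphi.
(* a quarter of the room available, so that both ramps, of width d, fit in it *)
pose D := Num.min d0 (Num.min a (Num.min (x - b) (Num.min e (x / 2)))).
have D0 : 0 < D by rewrite !lt_min d00 a0 subr_gt0 bx e0 divr_gt0.
have [] : [/\ D <= d0, D <= a & D <= x - b] /\ (D <= e /\ D <= x / 2).
  by rewrite /D !ge_min !lexx !orbT.
move=> [Dd0 Da Db] [De Dx]; pose d := D / 4.
have d_gt0 : 0 < d by rewrite divr_gt0.
have dD : D = d * 4 by rewrite /d; lra.
have dd0 : 0 < d < d0 by rewrite d_gt0/=; lra.
have c1 := C1_ramp d d; have c2 := C1_ramp (x - 2 * d) d.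
have r1 : pairing u (ramp d d) = 0.
  apply: pairing_ramp_ae0 => //; [exact: ltW|lra|].
  apply: ae_imp u0 => y uy0; rewrite in_itv/= => /andP[yd y2d].
  by apply: uy0; rewrite in_itv/=; apply/andP; split; lra.
have C1eta := C1B (C1B c1 c2) C1phi.
have ceta : cutoffs x ((ramp d d \- ramp (x - 2 * d) d) \- phi).
  split; first exact: C1eta.
    exists d, (x - d); split=> //; first by rewrite gtrBl.
    move=> y /=; apply: contraNT; rewrite negb_and -!ltNge => /orP yd.
    have -> : phi y = 0.
      by apply/eqP; apply: contraT => /sphi/andP[? ?]; case: yd => ?; lra.
    rewrite subr0; case: yd => yd.
      by rewrite !ramp_le ?subrr//; lra.
    by rewrite !ramp_ge ?subrr//; lra.
  move=> y /=; have /andP[p0 p1] := phi01 y.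
  have /andP[q0 q1] := ramp_itv d d y.
  have /andP[s0 s1] := ramp_itv (x - 2 * d) d y.
  have [phi0|/sphi/andP[ay yb]] := eqVneq (phi y) 0; last first.
    by rewrite ramp_ge ?ramp_le//; lra.
  rewrite phi0 subr0; have [y2d|y2d] := leP (d + d) y.
    by rewrite ramp_ge//; lra.
  by rewrite (@ramp_le (x - 2 * d))//; lra.
have := Hd d dd0; rewrite ler_norml => /andP[Hd1 _].
apply: le_trans (lerD (neg_variation_ge (unit_variationN iu vu)
  (integrable01N iu) (ltW x1) ceta) (lexx eps)).
rewrite (pairingNl iu C1eta) (pairingB iu (C1B c1 c2) C1phi) (pairingB iu c1 c2).
rewrite r1; move: Hd1; clear; move: (u x) (pairing u _) (pairing u _) => v p q; lra.
Qed.

(** * Jordan decomposition into two transitions *)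

(** These play the role of distribution functions of positive measures of mass 1/2
    carried by [e, 1 - e]. *)
Definition transition e p := [/\ {homo p : x y / x <= y},
  forall x, x < e -> p x = 0 & forall x, 1 - e < x -> p x = 2^-1].

Lemma ae_itv_ex (P : R -> Prop) (a b : R) : a < b ->
  {ae mu, forall x, P x} -> exists2 x, x \in `]a, b[ & P x.
Proof.
move=> ab aeP; apply: contrapT => nex.
have : mu.-negligible `]a, b[.
  apply: negligibleS aeP => x /= xab Px; apply: nex; by exists x.
move/measure_negligible => /(_ (measurable_itv _)).
rewrite /= lebesgue_measure_itv/= lte_fin ab -EFinD => -[] /eqP.
by rewrite subr_eq0 gt_eqF.
Qed.

(** The common value 1/2 after 1 - e may create a jump there; it adds the mass
    missing when the variation of u is less than 1. *)
Lemma neg_variation_transition u e : 0 < e -> e < 2^-1 -> unit_variation u ->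
  integrable01 u -> {ae mu, forall y, y \in `]0, e[ -> u y = 0} ->
  (forall x, x <= 1 - e -> neg_variation u x <= 2^-1) ->
  transition e (fun x => if x <= 1 - e then neg_variation u x else 2^-1).
Proof.
move=> e0 e2 vu iu u0 half.
have e1 : e <= 1 - e by lra.
have e1' : 1 - e <= 1 by lra.
split=> [x y xy|x xe|x xe].
- case: ifPn => xe; case: ifPn => ye.
  + apply: neg_variation_homo => //; exact: le_trans ye e1'.
  + exact: half.
  + by move: xe; rewrite (le_trans xy ye).
  + exact: lexx.
- rewrite (le_trans (ltW xe) e1).
  exact: (neg_variation_eq0 iu (ltW xe) u0).
- by rewrite leNgt xe.
Qed.

(** At a Lebesgue point y in (1 - e, 1) where u vanishes, the two variations
    coincide and their sum is at most 1; so both are at most 1/2 there, and at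
    every smaller point. *)
Lemma unit_variation_jordan u e : 0 < e -> e < 2^-1 ->
  integrable01 u -> unit_variation u ->
  {ae mu, forall x, x \in `]0, e[ -> u x = 0} ->
  {ae mu, forall x, x \in `]1 - e, 1[ -> u x = 0} ->
  exists p n, [/\ transition e p, transition e n &
    {ae mu, forall x, x \in `]0, 1[ -> u x = p x - n x}].
Proof.
move=> e0 e2 iu vu u0 u1.
have iN := integrable01N iu; have vN := unit_variationN iu vu.
have uK : \- (\- u) = u by apply/funext => x /=; rewrite opprK.
have u0N : {ae mu, forall x, x \in `]0, e[ -> (\- u) x = 0}.
  by apply: ae_imp u0 => x /= ux /ux ->; rewrite oppr0.
have e1 : e <= 1 by lra.
pose good x := x \in `]0, 1[ ->
  neg_variation (\- u) x - neg_variation u x = u x.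
have aegood : {ae mu, forall x, good x}.
  apply: ae_imp (ae_and (lebesgue_pt01_ae iu) (lebesgue_pt01_ae iN)).
  move=> x [lp lm]; rewrite /good in_itv/= => x01; apply/eqP.
  have j1 := neg_variation_jump vu iu e0 e1 u0 x01 lp.
  have := neg_variation_jump vN iN e0 e1 u0N x01 lm; rewrite uK => j2.
  rewrite subr_eq eq_le [_ + neg_variation _ _]addrC j1 andbT.
  by move: j2; rewrite /= lerBlDr addrC.
have [y yI [gy uy]] : exists2 y, y \in `]1 - e, 1[ &
    good y /\ (y \in `]1 - e, 1[ -> u y = 0).
  by apply: ae_itv_ex (ae_and aegood u1); lra.
have y01 : y \in `]0, 1[.
  by move: yI; rewrite !in_itv/= => /andP[? ->]; rewrite andbT; lra.
have y1 : y <= 1 by move: y01; rewrite in_itv/= => /andP[_ /ltW].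
have Weq : neg_variation (\- u) y = neg_variation u y.
  by apply/eqP; rewrite -subr_eq0 gy// uy.
have Wle := neg_variationD vu iu y1.
have half : neg_variation u y <= 2^-1.
  by move: Wle; rewrite Weq; move: (neg_variation u y) => w; clear; lra.
have below x : x <= 1 - e -> x <= y.
  by move: yI; rewrite in_itv/= => /andP[/ltW ey _] xe; exact: le_trans ey.
pose W v x := if x <= 1 - e then neg_variation v x else 2^-1.
exists (W (\- u)), (W u); split.
- apply: neg_variation_transition => // x /below xy.
  by apply: le_trans (neg_variation_homo vN iN xy y1) _; rewrite Weq.
- apply: neg_variation_transition => // x /below xy.
  by apply: le_trans (neg_variation_homo vu iu xy y1) _.
- apply: ae_imp (ae_and aegood u1) => x [gx ux] x01; rewrite /W.
  case: leP => xe; first by rewrite gx.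
  rewrite subrr ux//; move: x01; rewrite !in_itv/= => /andP[_ ->].
  by rewrite xe.
Qed.

Lemma pairing_le u phi M C : measurable_fun setT u ->
  (forall x, `|u x| <= M) -> C1 phi ->
  (forall x, x \in `[0, 1] -> `|derive1 phi x| <= C) ->
  `|pairing u phi| <= M * C.
Proof.
move=> mu_ uM cphi HC; have iu := integrable01_bounded mu_ uM.
have i1 := integrable01M iu cphi.2.
apply: le_trans (le_normr_Rintegral _ i1) _ => //.
apply: (@le_trans _ _ (\int[mu]_(x in `]0, 1[) (cst (M * C) x))).
  apply: le_Rintegral => //.
  - exact: (integrable_norm i1).
  - exact: integrable01_cst.
  - move=> x /= /subset_itv_oo_cc x01; rewrite normrM ler_pM//.
    exact: HC.
rewrite Rintegral_cst//= lebesgue_measure_itv/= lte_fin ltr01/= subr0.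
by rewrite mulr1.
Qed.

(** * Monotone functions have small pairings *)

Lemma Cc1_01_eq1 phi : Cc1_01 phi -> phi 1 = 0.
Proof.
move=> [_ _ _ sphi]; apply/eqP; apply: contraT => phi1.
have : `]0, 1[%classic (1 : R) by apply: sphi; exact: subset_closure.
by rewrite /= in_itv/= ltxx andbF.
Qed.

(** If A meets (0,1), it does so in an interval with endpoints c and 1, and the pairing
    equals - phi(c). *)
Lemma pairing_upper_set (A : set R) phi : measurable A ->
  (forall x y, x <= y -> A x -> A y) -> Cc1_01 phi ->
  (forall x, `|phi x| <= 1) -> `|pairing \1_A phi| <= 1.
Proof.
move=> mA upA cphi phi1; have C1phi : C1 phi by case: cphi.
have restr : pairing \1_A phi =
    (\int[mu]_(x in `]0, 1[ `&` A) derive1 phi x)%R.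
  rewrite Rintegral_mkcondr; apply: eq_Rintegral => x _.
  by rewrite patchE indicE; case: ifPn => _; rewrite ?mul1r ?mul0r.
rewrite restr; set B := `]0, 1[ `&` A.
have [B0|/set0P[b Bb]] := eqVneq B set0.
  by rewrite B0 Rintegral_set0 normr0.
pose c := inf B.
have lbB : lbound B 0 by move=> x [/=]; rewrite in_itv/= => /andP[/ltW].
have hB : has_inf B by split; [exists b|exists 0].
have c0 : 0 <= c by apply: lb_le_inf => //; exists b.
have cb : c <= b by apply: ge_inf => //; exists 0.
have c1 : c < 1.
  by apply: le_lt_trans cb _; case: Bb => /=; rewrite in_itv/= => /andP[].
have Bgt x : c < x -> x < 1 -> B x.
  move=> cx x1; split; first by rewrite /= in_itv/= x1 (le_lt_trans c0 cx).
  have cx0 : 0 < x - c by rewrite subr_gt0.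
  have [y [_ Ay] yx] := inf_adherent cx0 hB.
  by apply: (upA y) => //; apply: ltW; rewrite addrC subrK in yx.
have -> : (\int[mu]_(x in B) derive1 phi x)%R =
          (\int[mu]_(x in `]c, 1[) derive1 phi x)%R.
  have [Bc|nBc] := pselect (B c).
    have -> : B = `[c, 1[%classic.
      apply/seteqP; split=> x /=; rewrite in_itv/=.
        move=> Bx; apply/andP; split; first by apply: ge_inf => //; exists 0.
        by case: Bx => /=; rewrite in_itv/= => /andP[].
      by move=> /andP[]; rewrite le_eqVlt => /predU1P[<-//|]; exact: Bgt.
    rewrite Rintegral_itv_obnd_cbnd//.
    apply: (@integrableS _ _ _ mu `[0, 1]) => //.
      move=> x /=; rewrite !in_itv/= => /andP[cx /ltW ->].
      by rewrite (le_trans c0 (ltW cx)).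
    apply: continuous_compact_integrable; first exact: segment_compact.
    exact: continuous_subspaceT C1phi.2.
  congr Rintegral; apply/seteqP; split=> x /=; rewrite in_itv/=.
    move=> Bx; apply/andP; split; last first.
      by case: Bx => /=; rewrite in_itv/= => /andP[].
    rewrite lt_neqAle; apply/andP; split; last by apply: ge_inf => //; exists 0.
    by apply/eqP => cx; apply: nBc; rewrite cx.
  by move=> /andP[]; exact: Bgt.
by rewrite (FTC_C1 C1phi (ltW c1)) (Cc1_01_eq1 cphi) sub0r normrN.
Qed.

(** The sum is the integer part of y. *)
Lemma count_levels (n : nat) (y : R) : 0 <= y <= n%:R ->
  y - 1 <= \sum_(k < n) (k.+1%:R <= y)%R%:R <= y.
Proof.
elim: n y => [|n IH] y /andP[y0 yn].
  by rewrite big_ord0; apply/andP; split; lra.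
have [yn'|yn'] := leP y n%:R.
  rewrite big_ord_recr/= (_ : (n.+1%:R <= y) = false) ?addr0.
    by apply: IH; rewrite y0.
  by apply/negbTE; rewrite -ltNge (le_lt_trans yn')// ltr_nat.
rewrite big_ord_recr/= (eq_bigr (fun=> 1)); last first.
  move=> k _; rewrite (_ : _ <= y)//; apply: ltW; apply: le_lt_trans yn'.
  by rewrite ler_nat.
rewrite sumr_const card_ord.
move: yn; rewrite -natr1 => yn.
have [h|h] := leP (n%:R + 1) y.
  by rewrite /=; apply/andP; split; lra.
by rewrite /=; apply/andP; split; lra.
Qed.

Lemma pairing_levels_le (n : nat) (A : nat -> set R) phi :
  (forall k, measurable (A k)) ->
  (forall k x y, x <= y -> A k x -> A k y) -> Cc1_01 phi ->
  (forall x, `|phi x| <= 1) ->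
  integrable01 (fun x => \sum_(k < n) \1_(A k) x) /\
  `|pairing (fun x => \sum_(k < n) \1_(A k) x) phi| <= n%:R.
Proof.
move=> mA upA cphi phi1; have C1phi : C1 phi by case: cphi.
have iA k : integrable01 \1_(A k).
  apply: (@integrable01_bounded _ 1) => // x.
  by rewrite ger0_norm// indicE lern1 leq_b1.
elim: n => [|n [IHi IH]].
  have -> : (fun x => \sum_(k < 0) \1_(A k) x) = cst 0 :> (R -> R).
    by apply/funext => x; rewrite big_ord0.
  split; first exact: integrable01_cst.
  by rewrite pairing_cst// mul0r normr0.
have -> : (fun x => \sum_(k < n.+1) \1_(A k) x) =
    (fun x => \sum_(k < n) \1_(A k) x) \+ \1_(A n) :> (R -> R).
  by apply/funext => x; rewrite big_ord_recr.
split; first exact: (integrableD _ IHi (iA n)).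
rewrite (pairingDl IHi (iA n) C1phi) -natr1 (le_trans (ler_normD _ _))//.
by rewrite lerD//; apply: pairing_upper_set => //; exact: upA.
Qed.

(** Rounding q down to an integer gives a sum of n indicators of upper sets, each
    pairing to at most 1, and leaves a remainder with values in [0,1]. *)
Lemma pairing_nondecreasing q phi (n : nat) C : {homo q : x y / x <= y} ->
  (forall x, 0 <= q x <= n%:R) -> Cc1_01 phi -> (forall x, `|phi x| <= 1) ->
  (forall x, x \in `[0, 1] -> `|derive1 phi x| <= C) ->
  `|pairing q phi| <= n%:R + C.
Proof.
move=> q_homo q_itv cphi phi1 HC; have C1phi : C1 phi by case: cphi.
have mq : measurable_fun setT q by exact: nondecreasing_measurable.
pose A k := [set x | k.+1%:R <= q x].
have mA k : measurable (A k).
  have := mq measurableT `[k.+1%:R, +oo[%classic (measurable_itv _).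
  rewrite setTI; congr (measurable _); apply/seteqP; split=> x /=;
    by rewrite in_itv/= andbT.
have upA k x y : x <= y -> A k x -> A k y.
  by move=> /q_homo xy; rewrite /A /= => /le_trans; apply.
have [iS leS] := pairing_levels_le n mA upA cphi phi1.
pose S := fun x => \sum_(k < n) \1_(A k) x : R.
have mS : measurable_fun setT S.
  apply: measurable_sum => k; exact: measurable_indic.
have qS x : `|q x - S x| <= 1.
  have := count_levels (q_itv x).
  have -> : \sum_(k < n) (k.+1%:R <= q x)%R%:R = S x.
    apply: eq_bigr => k _; rewrite indicE; congr (_ %:R); congr nat_of_bool.
    by apply/idP/idP; rewrite inE.
  by move=> /andP[? ?]; rewrite ler_norml; apply/andP; split; lra.
have mqS : measurable_fun setT (q \- S) by exact: measurable_funB.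
have -> : q = S \+ (q \- S) by apply/funext => x /=; rewrite addrC subrK.
rewrite pairingDl//; last exact: (integrable01_bounded mqS qS).
rewrite (le_trans (ler_normD _ _))// lerD// -[leRHS]mul1r.
exact: pairing_le.
Qed.

Lemma transition_itv e p : 0 < e -> e < 2^-1 -> transition e p ->
  forall x, 0 <= p x <= 2^-1.
Proof.
move=> e0 e2 [p_homo p0 p1] x; apply/andP; split.
  have xx : Num.min x 0 < e by rewrite gt_min e0 orbT.
  by rewrite -(p0 _ xx); apply: p_homo; rewrite ge_min lexx.
have xx : 1 - e < Num.max x 1 by rewrite lt_max gtrBl e0 orbT.
by rewrite -(p1 _ xx); apply: p_homo; rewrite le_max lexx.
Qed.

(** Apply [pairing_nondecreasing] to 2 n p, divide by 2 n, and let n grow. *)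
Lemma pairing_transition e p phi : 0 < e -> e < 2^-1 -> transition e p ->
  Cc1_01 phi -> (forall x, `|phi x| <= 1) -> `|pairing p phi| <= 2^-1.
Proof.
move=> e0 e2 tp cphi phi1; have C1phi : C1 phi by case: cphi.
have pI := transition_itv e0 e2 tp; have [p_homo _ _] := tp.
have [C HC] := continuous_bounded01 C1phi.2.
have C0 : 0 <= C by apply: le_trans (HC 0 _) => //; rewrite in_itv/= lexx ler01.
have mp : measurable_fun setT p by exact: nondecreasing_measurable.
have ip : integrable01 p.
  apply: (integrable01_bounded (M := 2^-1) mp) => x.
  by have /andP[? ?] := pI x; rewrite ger0_norm.
apply/ler_addgt0Pr => eps eps0.
(* the error term C / (2 n) has to be below eps *)
pose n := (Num.truncn (C / eps)).+1.
have nC : C < n%:R * eps by rewrite -ltr_pdivrMr// truncnS_gt.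
have n0 : 0 < n%:R :> R by rewrite ltr0n.
pose q x := (2 * n%:R) * p x.
have := @pairing_nondecreasing q phi n C _ _ cphi phi1 HC.
have -> : pairing q phi = (2 * n%:R) * pairing p phi.
  rewrite /pairing -RintegralZl//; last exact: integrable01M ip C1phi.2.
  by apply: eq_Rintegral => x _; rewrite mulrA.
rewrite normrM ger0_norm ?mulr_ge0//; move: (pairing p phi) => P H.
have : 2 * n%:R * `|P| <= n%:R + C.
  apply: H => [x y xy|x]; first by rewrite ler_pM2l ?mulr_gt0// p_homo.
  have /andP[? ?] := pI x; rewrite mulr_ge0 ?mulr_ge0//=.
  by rewrite /q -[leRHS]mulr1 -mulrA [n%:R * _]mulrC mulrA mulrC ler_pM2l//; lra.
move=> {}H; rewrite -(ler_pM2l n0) mulrDr.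
move: (`|P|) H => Q H; clear -H nC C0; lra.
Qed.

End real_functions.

Section classes.
Context {R : realType}.
Implicit Types (phi p q n f g : R -> R) (x y a b c e s : R) (u v w : Linf01 R).
Local Notation mu := (@lebesgue_measure R).
Local Notation mu01 := (leb01 R).
Local Notation integrable01 f := (mu.-integrable `]0, 1[ (EFin \o f)).

(** * The unit ball of G in terms of transitions *)

Lemma ae01P (P : R -> Prop) : {ae mu01, forall x, P x} <->
  {ae mu, forall x, x \in `]0, 1[ -> P x}.
Proof.
split=> [] [N [mN N0 sN]].
  exists (N `&` `]0, 1[); split.
  - exact: measurableI.
  - exact: N0.
  - move=> x /= /not_implyP[x01 nP]; split=> //; exact: sN.
exists (N `|` ~` `]0, 1[); split.
- by apply: measurableU => //; exact: measurableC.
- apply/eqP; rewrite eq_le measure_ge0 andbT.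
  apply: (@le_trans _ _ (mu N)); last by rewrite N0.
  rewrite /leb01 /mrestr; apply: le_measure; rewrite ?inE//.
    by apply: measurableI => //; apply: measurableU => //; exact: measurableC.
  by move=> x [[//|] nx /nx].
- move=> x /= nP; have [x01|x01] := pselect (`]0, 1[%classic x); last by right.
  by left; apply: sN => /=; apply/not_implyP.
Qed.

Lemma ae_eq01P (f g : R -> R) : ae_eq mu01 setT f g <->
  {ae mu, forall x, x \in `]0, 1[ -> f x = g x}.
Proof.
rewrite -ae01P; split; apply: ae_imp => x //.
by apply.
Qed.

Lemma Linf01_measurable u : measurable_fun setT (u : R -> R).
Proof.
exact: (@measurable_funPT _ _ (measurableTypeR R) (measurableTypeR R)
  (repr (LebesgueSpace.sort u))).
Qed.

Lemma pairing_ae_eq f g phi :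
  measurable_fun setT f -> measurable_fun setT g -> C1 phi ->
  {ae mu, forall x, x \in `]0, 1[ -> f x = g x} ->
  (\int[mu]_(x in `]0%R, 1%R[) (f x * derive1 phi x)%:E =
   \int[mu]_(x in `]0%R, 1%R[) (g x * derive1 phi x)%:E)%E.
Proof.
move=> mf mg [_ cphi] fg; have mphi := continuous_measurable_fun cphi.
apply: ae_eq_integral => //.
- by apply: measurable_funTS; apply/measurable_EFinP; exact: measurable_funM.
- by apply: measurable_funTS; apply/measurable_EFinP; exact: measurable_funM.
- by apply: ae_imp fg => x fgx x01; rewrite fgx.
Qed.

Lemma pairing_EFin (f : R -> R) phi : integrable01 f -> C1 phi ->
  (\int[mu]_(x in `]0%R, 1%R[) (f x * derive1 phi x)%:E = (pairing f phi)%:E)%E.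
Proof.
move=> ifn cphi; rewrite /pairing /Rintegral fineK//.
have := integrable01M ifn cphi.2.
exact: integrable_fin_num.
Qed.

Lemma ball_jordan e u : 0 < e -> e < 2^-1 -> ball_G01 e u ->
  exists p n, [/\ transition e p, transition e n & ae_eq mu01 setT u (p \- n)].
Proof.
move=> e0 e2; rewrite /ball_G01/= /G01; case: ifPn => // /asboolP[[iu _] u0] tv.
have vu : unit_variation u.
  move=> phi cphi phi1; have C1phi : C1 phi by case: cphi.
  rewrite -lee_fin -pairing_EFin//; apply: le_trans tv.
  by apply: ereal_sup_ubound; exists phi.
have [||p [n [tp tn upn]]] := @unit_variation_jordan _ u e e0 e2 iu vu.
- by apply: ae_imp u0 => x ux xI; apply: ux; left.
- by apply: ae_imp u0 => x ux xI; apply: ux; right.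
- by exists p, n; split=> //; apply/ae_eq01P.
Qed.

Lemma transition_measurable e p : transition e p -> measurable_fun setT p.
Proof. by case=> hp _ _; exact: nondecreasing_measurable. Qed.

Lemma transitionB_norm_le e p n : 0 < e -> e < 2^-1 ->
  transition e p -> transition e n -> forall x, `|p x - n x| <= 1.
Proof.
move=> e0 e2 tp tn x.
have /andP[? ?] := transition_itv e0 e2 tp x.
have /andP[? ?] := transition_itv e0 e2 tn x.
by rewrite ler_norml; apply/andP; split; lra.
Qed.

(** The pairing with p - n is at most 1/2 + 1/2. *)
Lemma ball_transitions e u p n : 0 < e -> e < 2^-1 ->
  transition e p -> transition e n -> ae_eq mu01 setT u (p \- n) -> ball_G01 e u.
Proof.
move=> e0 e2 tp tn /ae_eq01P upn.
have mp := transition_measurable tp; have mn := transition_measurable tn.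
have mpn : measurable_fun setT (p \- n) by exact: measurable_funB.
have pn1 := transitionB_norm_le e0 e2 tp tn.
have ipn : integrable01 (p \- n) by exact: integrable01_bounded pn1.
have [ip in_] : integrable01 p /\ integrable01 n.
  split; apply: (@integrable01_bounded _ _ 2^-1) => // x.
    by have /andP[? ?] := transition_itv e0 e2 tp x; rewrite ger0_norm.
  by have /andP[? ?] := transition_itv e0 e2 tn x; rewrite ger0_norm.
have mu_ := Linf01_measurable u.
have tv : (total_variation01 u <= 1)%E.
  apply: ge_ereal_sup => _ [phi [cphi phi1] <-].
  have C1phi : C1 phi by case: cphi.
  rewrite (pairing_ae_eq mu_ mpn C1phi upn) (pairing_EFin ipn C1phi) lee_fin.
  rewrite (pairingDl ip (integrable01N in_) C1phi) (pairingNl in_ C1phi).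
  have := pairing_transition e0 e2 tp cphi phi1.
  have := pairing_transition e0 e2 tn cphi phi1.
  move: (pairing n phi) (pairing p phi) => a b; clear.
  by rewrite !ler_norml => /andP[? ?] /andP[? ?]; lra.
rewrite /ball_G01/= /G01; case: ifPn => // /asboolP; case; split; first split.
- apply/integrableP; split.
    by apply: measurable_funTS; exact/measurable_EFinP.
  rewrite (@ae_eq_integral _ _ _ mu _ (fun x => `|((p \- n) x)%:E|%E))//.
  + by have /integrableP[] := ipn.
  + apply: measurable_funTS; apply: measurableT_comp => //; exact/measurable_EFinP.
  + apply: measurable_funTS; apply: measurableT_comp => //; exact/measurable_EFinP.
  + by apply: ae_imp upn => x ux /ux /= ->.
- exact: le_lt_trans tv (ltry _).
- apply: ae_imp upn => x ux [] /=; rewrite in_itv/= => /andP[xl xr].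
  + rewrite ux/=; last by rewrite in_itv/= xl/=; lra.
    by case: tp tn => _ p0 _ [_ n0 _]; rewrite p0// n0// subrr.
  + rewrite ux/=; last by rewrite in_itv/= xr andbT; lra.
    by case: tp tn => _ _ p1 [_ _ n1]; rewrite p1// n1// subrr.
Qed.

Lemma bounded_memLfun (f : R -> R) M : measurable_fun setT f ->
  (forall x, `|f x| <= M) ->
  f \in @Lfun _ (measurableTypeR R) R mu01 +oo%E.
Proof.
move=> mf fM; rewrite inE; apply/andP; split; rewrite inE//=.
rewrite /finite_norm unlock; case: ifPn => // mu0.
apply: (@le_lt_trans _ _ M%:E); last exact: ltry.
apply: ereal_inf_lbound; apply/nearW => x /=.
by rewrite lee_fin.
Qed.

Lemma Linf01_transitions e p n : 0 < e -> e < 2^-1 -> transition e p ->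
  transition e n -> exists u, ae_eq mu01 setT u (p \- n).
Proof.
move=> e0 e2 tp tn.
have mpn : measurable_fun setT (p \- n).
  apply: measurable_funB; first exact: transition_measurable tp.
  exact: transition_measurable tn.
exists (Linf01_class (Lfun_Sub (leey 1)
  (bounded_memLfun mpn (transitionB_norm_le e0 e2 tp tn)))).
exact: Linf01_class_ae.
Qed.

(** * Extreme points *)

Definition ae01 (P : R -> Prop) := {ae mu, forall x, x \in `]0, 1[ -> P x}.

Lemma ae01_imp (P Q : R -> Prop) :
  (forall x, x \in `]0, 1[ -> P x -> Q x) -> ae01 P -> ae01 Q.
Proof. by move=> PQ; apply: ae_imp => x Px x01; exact: PQ (Px x01). Qed.

Lemma ae01_and (P Q : R -> Prop) :
  ae01 P -> ae01 Q -> ae01 (fun x => P x /\ Q x).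
Proof.
by move=> aP aQ; apply: ae_imp (ae_and aP aQ) => x [Px Qx] x01; split; auto.
Qed.

Lemma ae01_neq a : ae01 (fun x => x != a).
Proof.
exists [set a]; split=> //; first exact: lebesgue_measure_set1.
by move=> x /= /not_implyP[_] /negP; rewrite negbK => /eqP.
Qed.

Lemma ae01_itv_ex (P : R -> Prop) a b : 0 <= a -> b <= 1 -> a < b ->
  ae01 P -> exists2 x, a < x < b & P x.
Proof.
move=> a0 b1 ab aP; have [x] := ae_itv_ex ab aP; rewrite in_itv/= => xab Px.
exists x => //; apply: Px; rewrite in_itv/=.
by have /andP[ax xb] := xab; rewrite (le_lt_trans a0 ax) (lt_le_trans xb b1).
Qed.

Lemma Linf01_ae01P u v : u = v <-> ae01 (fun x => u x = v x).
Proof. by rewrite Linf01_eqP ae_eq01P. Qed.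

(** Classes are handled through representatives, so that convex combinations
    become pointwise identities almost everywhere. *)
Lemma Linf01_convP u v w a b : u = a *: v + b *: w <->
  ae01 (fun x => u x = a * v x + b * w x).
Proof.
have h1 : ae01 (fun x => (a *: v + b *: w) x = (a *: v) x + (b *: w) x).
  exact: (ae_eq01P _ _).1 (Linf01_addE _ _).
have h2 : ae01 (fun x => (a *: v) x = a * v x).
  exact: (ae_eq01P _ _).1 (Linf01_scaleE _ _).
have h3 : ae01 (fun x => (b *: w) x = b * w x).
  exact: (ae_eq01P _ _).1 (Linf01_scaleE _ _).
have {h1 h2 h3}h : ae01 (fun x => (a *: v + b *: w) x = a * v x + b * w x).
  by apply: ae01_imp (ae01_and h1 (ae01_and h2 h3)) => x _ [-> [-> ->]].
rewrite Linf01_ae01P; split=> uE; apply: ae01_imp (ae01_and h uE) => x _ [hx ux].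
  exact: etrans ux hx.
exact: etrans ux (esym hx).
Qed.

Lemma Linf01_scaleP u v c : u = c *: v <-> ae01 (fun x => u x = c * v x).
Proof.
have -> : c *: v = c *: v + 0 *: v by rewrite scale0r addr0.
rewrite Linf01_convP; split; apply: ae01_imp => x _ ->; by rewrite mul0r addr0.
Qed.

Definition jump_at a x : R := if x < a then 0 else 2^-1.

Lemma jump_at_transition e a : a \in `[e, 1 - e] -> transition e (jump_at a).
Proof.
rewrite in_itv/= => /andP[ea ae1]; rewrite /jump_at; split=> [x y xy|x xe|x xe].
- case: ltP => xa; case: ltP => ya //.
  by rewrite leNgt (lt_le_trans ya)// in xy.
- by rewrite (lt_le_trans xe ea).
- by rewrite ltNge (le_trans ae1 (ltW xe)).
Qed.

(** Together with [transition_max], this writes p as the midpoint of two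
    transitions: its lower half and its upper half, both stretched by 2. *)
Lemma transition_min e p : transition e p ->
  transition e (fun x => Num.min (2 * p x) 2^-1).
Proof.
move=> [hp p0 p1]; split=> [x y xy|x xe|x xe].
- have := hp x y xy; rewrite le_min !ge_min lexx orbT andbT.
  by move=> h; rewrite ler_pM2l// h.
- by rewrite p0// mulr0 min_l.
- by rewrite p1// mulfV// min_r//; lra.
Qed.

Lemma transition_max e p : transition e p ->
  transition e (fun x => Num.max (2 * p x - 2^-1) 0).
Proof.
move=> [hp p0 p1]; split=> [x y xy|x xe|x xe].
- have := hp x y xy; rewrite ge_max !le_max lexx orbT andbT => h.
  by rewrite lerB// ler_pM2l// h.
- by rewrite p0// mulr0 sub0r max_r// oppr_le0 invr_ge0.
- by rewrite p1// mulfV// max_l//; lra.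
Qed.

Lemma transition_conv e s p q : 0 < s < 1 -> transition e p -> transition e q ->
  transition e (fun x => (1 - s) * p x + s * q x).
Proof.
move=> /andP[s0 s1] [hp p0 p1] [hq q0 q1]; split=> [x y xy|x xe|x xe].
- by rewrite lerD// ler_wpM2l ?hp ?hq ?subr_ge0// ltW.
- by rewrite p0// q0// !mulr0 addr0.
- by rewrite p1// q1// -mulrDl subrK mul1r.
Qed.

(** The equation leaves p(x) only the values 0 and 1/2, and a is the infimum of
    the points where p exceeds 1/4, halfway between them. *)
Lemma two_valued_transition e p : 0 < e -> transition e p ->
  ae01 (fun x => p x = Num.min (2 * p x) 2^-1) ->
  exists2 a, a \in `[e, 1 - e] & ae01 (fun x => x != a -> p x = jump_at a x).
Proof.
move=> e0 tp; have [hp p0 p1] := tp => pmin.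
pose A := [set x | 4^-1 <= p x]; pose a := inf A.
have A1 x : 1 - e < x -> A x by move=> /p1 px; rewrite /A/= px; lra.
have Ae : lbound A e.
  move=> x Ax; rewrite leNgt; apply/negP => /p0 px.
  by move: Ax; rewrite /A/= px; lra.
have hA : has_inf A by split; [exists 1; apply: A1; rewrite gtrBl|exists e].
have Aa x : a < x -> A x.
  rewrite -subr_gt0 => xa; have [y Ay] := inf_adherent xa hA.
  by rewrite -/a addrC subrK => /ltW /hp; exact: le_trans.
have nAa x : x < a -> ~ A x.
  by move=> xa Ax; have := ge_inf hA.2 Ax; rewrite leNgt xa.
exists a.
  rewrite in_itv/=; apply/andP; split; first by apply: lb_le_inf => //; exact: hA.1.
  rewrite leNgt; apply/negP => ae1.
  have : A ((1 - e + a) / 2) by apply: A1; lra.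
  by apply: nAa; lra.
apply: ae01_imp pmin => x _ px xa; rewrite /jump_at; case: ltP => xa'.
  have /negP := nAa _ xa'; rewrite -ltNge => p4; move: px.
  by case: leP; lra.
have : 4^-1 <= p x by apply: Aa; rewrite lt_neqAle eq_sym xa.
by move=> p4; move: px; case: leP; lra.
Qed.

Lemma extreme_midpoint e u p1 n1 p2 n2 : 0 < e -> e < 2^-1 ->
  extreme_points (ball_G01 e) u ->
  transition e p1 -> transition e n1 -> transition e p2 -> transition e n2 ->
  ae01 (fun x => u x = ((p1 x - n1 x) + (p2 x - n2 x)) / 2) ->
  ae01 (fun x => p1 x - n1 x = u x).
Proof.
move=> e0 e2 [_ ext] tp1 tn1 tp2 tn2 uE.
have [u1 u1E] := Linf01_transitions e0 e2 tp1 tn1.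
have [u2 u2E] := Linf01_transitions e0 e2 tp2 tn2.
have B1 := ball_transitions e0 e2 tp1 tn1 u1E.
have B2 := ball_transitions e0 e2 tp2 tn2 u2E.
move/ae_eq01P in u1E; move/ae_eq01P in u2E.
have uc : u = (1 - 2^-1) *: u1 + 2^-1 *: u2.
  apply/Linf01_convP; apply: ae01_imp (ae01_and uE (ae01_and u1E u2E)).
  move=> x _ [-> [-> ->]] /=; lra.
have s01 : 0 < (2^-1 : R) < 1 by lra.
have [/Linf01_ae01P u1u _] := ext _ _ _ B1 B2 s01 uc.
apply: ae01_imp (ae01_and u1u u1E) => x _ [h1 h2].
exact: etrans (esym h2) h1.
Qed.

Lemma extreme_positive_part e u p n : 0 < e -> e < 2^-1 ->
  extreme_points (ball_G01 e) u -> transition e p -> transition e n ->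
  ae01 (fun x => u x = p x - n x) ->
  ae01 (fun x => p x = Num.min (2 * p x) 2^-1).
Proof.
move=> e0 e2 ext tp tn up.
have := extreme_midpoint e0 e2 ext (transition_min tp) tn (transition_max tp) tn.
move=> H; have {}H := H _.
apply: ae01_imp (ae01_and up (H _)) => [x _ [-> /addIr]//|].
apply: ae01_imp up => x _ ->; move: (p x) (n x) => P N.
by case: (leP (2 * P)); case: (leP (2 * P - 2^-1)); lra.
Qed.

Lemma extreme_negative_part e u p n : 0 < e -> e < 2^-1 ->
  extreme_points (ball_G01 e) u -> transition e p -> transition e n ->
  ae01 (fun x => u x = p x - n x) ->
  ae01 (fun x => n x = Num.min (2 * n x) 2^-1).
Proof.
move=> e0 e2 ext tp tn up.
have := extreme_midpoint e0 e2 ext tp (transition_min tn) tp (transition_max tn).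
move=> H; have {}H := H _.
apply: ae01_imp (ae01_and up (H _)) => [x _ [-> /addrI/oppr_inj]//|].
apply: ae01_imp up => x _ ->; move: (p x) (n x) => P N.
by case: (leP (2 * N)); case: (leP (2 * N - 2^-1)); lra.
Qed.

Lemma Linf01_0E : ae01 (fun x => (0 : Linf01 R) x = 0).
Proof.
have : (0 : Linf01 R) = 0 *: 0 + 0 *: 0 by rewrite !scaler0 addr0.
by move/Linf01_convP; apply: ae01_imp => x _ ->; rewrite !mul0r addr0.
Qed.

(** The zero class is the midpoint of the half indicator of [e, 1 - e] and of its
    opposite. *)
Lemma not_extreme0 e : 0 < e -> e < 2^-1 -> ~ extreme_points (ball_G01 e) 0.
Proof.
move=> e0 e2 ext.
have tp : transition e (jump_at e).
  by apply: jump_at_transition; rewrite in_itv/= lexx/=; lra.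
have tn : transition e (jump_at (1 - e)).
  by apply: jump_at_transition; rewrite in_itv/= lexx andbT; lra.
have H : ae01 (fun x => jump_at e x - jump_at (1 - e) x = (0 : Linf01 R) x).
  apply: (extreme_midpoint e0 e2 ext tp tn tn tp).
  by apply: ae01_imp Linf01_0E => x _ ->; lra.
have [|||x /andP[ex xe] [hx zx]] := @ae01_itv_ex _ e (1 - e) _ _ _
  (ae01_and H Linf01_0E); [lra|lra|lra|].
move: hx; rewrite zx /jump_at ltNge (ltW ex)/= xe; lra.
Qed.

(** An end of the interval [0, m] is a convex combination only of itself. *)
Lemma convex_extremal s (P Q m : R) : 0 < s < 1 -> 0 <= P <= m -> 0 <= Q <= m ->
  (1 - s) * P + s * Q = 0 \/ (1 - s) * P + s * Q = m ->
  P = (1 - s) * P + s * Q /\ Q = (1 - s) * P + s * Q.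
Proof.
move=> /andP[s0 s1] /andP[P0 Pm] /andP[Q0 Qm] [] H; rewrite H; split; nra.
Qed.

(** The half indicator of [a, b] has only one decomposition into transitions P and
    N, up to null sets, and its values 0 and 1/2 are the ends of the range of
    every transition; so any convex splitting of P and N is trivial. *)
Lemma conv_jumps_unique e s p1 n1 p2 n2 a b :
  0 < e -> e < 2^-1 -> 0 < s < 1 ->
  transition e p1 -> transition e n1 -> transition e p2 -> transition e n2 ->
  a \in `[e, 1 - e] -> b \in `[e, 1 - e] -> a < b ->
  ae01 (fun x => x != a -> x != b -> (1 - s) * (p1 x - n1 x) + s * (p2 x - n2 x) =
                 jump_at a x - jump_at b x) ->
  ae01 (fun x => p1 x - n1 x = jump_at a x - jump_at b x /\
                 p2 x - n2 x = jump_at a x - jump_at b x).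
Proof.
move=> e0 e2 s01 tp1 tn1 tp2 tn2.
rewrite !in_itv/= => /andP[ea ae1] /andP[eb be1] ab conv.
have tP := transition_conv s01 tp1 tp2; have tN := transition_conv s01 tn1 tn2.
set P := (fun x => _) in tP; set N := (fun x => _) in tN.
have PI := transition_itv e0 e2 tP; have NI := transition_itv e0 e2 tN.
have [hP _ _] := tP; have [hN _ _] := tN.
have PN : ae01 (fun x => x != a -> x != b -> P x - N x = jump_at a x - jump_at b x).
  apply: ae01_imp conv => x _ h xa xb; rewrite -(h xa xb) /P /N; lra.
have mid x y : a <= x -> x < y -> y <= b ->
    exists2 z, x < z < y & P z = 2^-1 /\ N z = 0.
  move=> ax xy yb.
  have [|||z /andP[xz zy] hz] := @ae01_itv_ex _ x y _ _ _ PN;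
    [lra|lra|by []|].
  exists z; first by rewrite xz.
  have az : a < z by exact: le_lt_trans xz.
  have zb : z < b by exact: lt_le_trans yb.
  have := hz _ _; rewrite gt_eqF// lt_eqF// => /(_ erefl erefl).
  rewrite /jump_at zb ltNge (ltW az)/= subr0.
  have /andP[? ?] := PI z; have /andP[? ?] := NI z; split; lra.
(* P = 1/2 and N = 0 at almost every point of (a, b); monotonicity propagates
   the first equality to the right and the second one to the left *)
have Pa x : a < x -> P x = 2^-1.
  move=> ax; have [|||z /andP[az zx] [Pz _]] := mid a (Num.min x b).
  - exact: lexx.
  - by rewrite lt_min ax.
  - by rewrite ge_min lexx orbT.
  have /andP[_ Px] := PI x; apply/eqP; rewrite eq_le Px -Pz hP//.
  by move: zx; rewrite lt_min => /andP[/ltW].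
have Nb x : x < b -> N x = 0.
  move=> xb; have [|||z /andP[xz zb] [_ Nz]] := mid (Num.max a x) b.
  - by rewrite le_max lexx.
  - by rewrite gt_max ab.
  - exact: lexx.
  have /andP[Nx _] := NI x; apply/eqP; rewrite eq_le Nx andbT -Nz hN//.
  by move: xz; rewrite gt_max => /andP[_ /ltW].
apply: ae01_imp (ae01_and PN (ae01_and (ae01_neq a) (ae01_neq b))).
move=> x _ [h [xa xb]]; have {}h := h xa xb.
have [PE NE] : P x = jump_at a x /\ N x = jump_at b x.
  move: h; rewrite /jump_at; case: ltP => ax; case: ltP => bx.
  - by rewrite Nb// !subr0.
  - by have := lt_le_trans ax (le_trans (ltW ab) bx); rewrite ltxx.
  - by rewrite Nb// !subr0.
  - by rewrite Pa ?lt_neqAle 1?eq_sym ?xa// => /addrI/oppr_inj.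
have jE c y : jump_at c y = 0 \/ jump_at c y = 2^-1.
  by rewrite /jump_at; case: ifP; [left|right].
have [p1E p2E] : p1 x = P x /\ p2 x = P x.
  apply: (convex_extremal s01 (transition_itv e0 e2 tp1 x)
    (transition_itv e0 e2 tp2 x)).
  by rewrite -/(P x) PE; exact: jE.
have [n1E n2E] : n1 x = N x /\ n2 x = N x.
  apply: (convex_extremal s01 (transition_itv e0 e2 tn1 x)
    (transition_itv e0 e2 tn2 x)).
  by rewrite -/(N x) NE; exact: jE.
by rewrite p1E p2E n1E n2E PE NE.
Qed.

(** The difference of the two jumps is the half indicator of the half-open interval
    [a, b), whence the exception at b. *)
Lemma half_indic_jumps u a b sigma : a < b ->
  u = (sigma * 2^-1) *: Linf01_indic a b <->
  ae01 (fun x => x != b -> u x = sigma * (jump_at a x - jump_at b x)).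
Proof.
move=> ab.
have ind : ae01 (fun x => Linf01_indic a b x = \1_(`[a, b]) x).
  exact: (ae_eq01P _ _).1 (Linf01_class_ae _).
have val x : x != b -> sigma * 2^-1 * \1_(`[a, b]) x =
    sigma * (jump_at a x - jump_at b x).
  move=> xb; rewrite -mulrA; congr (_ * _); rewrite indicE /jump_at.
  case: (ltP x a) => xa; last case: (ltP x b) => xb'.
  - rewrite memNset ?mulr0 ?(lt_trans xa ab) ?subrr// => /=.
    by rewrite in_itv/= leNgt xa.
  - by rewrite mem_set ?mulr1 ?subr0//= in_itv/= xa ltW.
  - rewrite memNset ?mulr0 ?subrr//= in_itv/= xa/= => bx.
    by move: xb; rewrite eq_le xb' bx.
rewrite Linf01_scaleP; split => uE.
  by apply: ae01_imp (ae01_and uE ind) => x _ [-> ->]; exact: val.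
apply: ae01_imp (ae01_and uE (ae01_and ind (ae01_neq b))) => x _ [ux [-> xb]].
by rewrite val// ux.
Qed.

Lemma extreme_is_half_indic e u : 0 < e -> e < 2^-1 ->
  extreme_points (ball_G01 e) u -> exists a b sigma : R,
     [/\ a \in `[e, 1 - e], b \in `[e, 1 - e], a < b,
         (sigma = -1 \/ sigma = 1) &
         u = (sigma * 2^-1) *: Linf01_indic a b].
Proof.
move=> e0 e2 ext; have [p [n [tp tn /ae_eq01P upn]]] := ball_jordan e0 e2 ext.1.
have [a ae pa] := two_valued_transition e0 tp
  (extreme_positive_part e0 e2 ext tp tn upn).
have [b be nb] := two_valued_transition e0 tn
  (extreme_negative_part e0 e2 ext tp tn upn).
have uE : ae01 (fun x => x != a -> x != b -> u x = jump_at a x - jump_at b x).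
  apply: ae01_imp (ae01_and upn (ae01_and pa nb)) => x _ [ux [px nx]] xa xb.
  by rewrite ux /= px// nx.
have [ab|ba|ab] := ltgtP a b.
- exists a, b, 1; split=> //; first by right.
  apply/half_indic_jumps => //.
  apply: ae01_imp (ae01_and uE (ae01_neq a)) => x _ [ux xa] xb.
  by rewrite ux// mul1r.
- exists b, a, (- 1); split=> //; first by left.
  apply/half_indic_jumps => //.
  apply: ae01_imp (ae01_and uE (ae01_neq b)) => x _ [ux xb] xa.
  by rewrite ux// mulN1r opprB.
- have u0 : u = 0.
    have -> : (0 : Linf01 R) = 0 *: u by rewrite scale0r.
    apply/Linf01_scaleP; apply: ae01_imp (ae01_and uE (ae01_neq a)) => x _ [ux xa].
    by rewrite mul0r ux -?ab// subrr.
  by case: (not_extreme0 e0 e2); rewrite -u0.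
Qed.

(** When sigma = - 1 the transitions p and n exchange their roles. *)
Lemma half_indic_extreme e u a b sigma : 0 < e -> e < 2^-1 ->
  a \in `[e, 1 - e] -> b \in `[e, 1 - e] -> a < b ->
  (sigma = -1 \/ sigma = 1) -> u = (sigma * 2^-1) *: Linf01_indic a b ->
  extreme_points (ball_G01 e) u.
Proof.
move=> e0 e2 aI bI ab sg /half_indic_jumps -/(_ ab) uE.
have ta := jump_at_transition aI; have tb := jump_at_transition bI.
split.
  case: sg uE => -> uE; [apply: (ball_transitions e0 e2 tb ta)|
                         apply: (ball_transitions e0 e2 ta tb)];
  apply/ae_eq01P; apply: ae01_imp (ae01_and uE (ae01_neq b)) => x _ [ux xb];
  by rewrite ux// ?mulN1r ?opprB ?mul1r.
(* restated for u1 and u2 in the concrete type, where they can be evaluated *)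
suff key (u1 u2 : Linf01 R) s : ball_G01 e u1 -> ball_G01 e u2 ->
  0 < s < 1 -> u = (1 - s) *: u1 + s *: u2 -> u1 = u /\ u2 = u by exact: key.
move=> /(ball_jordan e0 e2) [p1 [n1 [tp1 tn1 /ae_eq01P u1E]]].
move=> /(ball_jordan e0 e2) [p2 [n2 [tp2 tn2 /ae_eq01P u2E]]] s01 /Linf01_convP uc.
have cv : ae01 (fun x => x != a -> x != b ->
    (1 - s) * (p1 x - n1 x) + s * (p2 x - n2 x) =
    sigma * (jump_at a x - jump_at b x)).
  apply: ae01_imp (ae01_and (ae01_and u1E u2E) (ae01_and uc uE)).
  by move=> x _ [[/= u1x u2x] [ux ux']] _ xb; rewrite -u1x -u2x -ux ux'.
suff [H1 H2] : ae01 (fun x => u1 x = sigma * (jump_at a x - jump_at b x)) /\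
               ae01 (fun x => u2 x = sigma * (jump_at a x - jump_at b x)).
  split; apply/Linf01_ae01P.
    apply: ae01_imp (ae01_and (ae01_and uE (ae01_neq b)) H1).
    by move=> x _ [[ux xb] h]; exact: etrans h (esym (ux xb)).
  apply: ae01_imp (ae01_and (ae01_and uE (ae01_neq b)) H2).
  by move=> x _ [[ux xb] h]; exact: etrans h (esym (ux xb)).
case: sg cv => -> cv.
  have cvN : ae01 (fun x => x != a -> x != b ->
      (1 - s) * (n1 x - p1 x) + s * (n2 x - p2 x) = jump_at a x - jump_at b x).
    apply: ae01_imp cv => x _ h xa xb; have := h xa xb; lra.
  have := conv_jumps_unique e0 e2 s01 tn1 tp1 tn2 tp2 aI bI ab cvN.
  move=> H; split.
    apply: ae01_imp (ae01_and H u1E) => x _ [[h _] ->] /=.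
    by rewrite mulN1r -h opprB.
  apply: ae01_imp (ae01_and H u2E) => x _ [[_ h] ->] /=.
  by rewrite mulN1r -h opprB.
have cv1 : ae01 (fun x => x != a -> x != b ->
    (1 - s) * (p1 x - n1 x) + s * (p2 x - n2 x) = jump_at a x - jump_at b x).
  by apply: ae01_imp cv => x _ h xa xb; rewrite h// mul1r.
have H := conv_jumps_unique e0 e2 s01 tp1 tn1 tp2 tn2 aI bI ab cv1.
split.
  by apply: ae01_imp (ae01_and H u1E) => x _ [[h _] ->] /=; rewrite mul1r.
by apply: ae01_imp (ae01_and H u2E) => x _ [[_ h] ->] /=; rewrite mul1r.
Qed.

End classes.

Theorem theorem6p10 (R : realType) (e : R)
  (he0 : 0 < e) (he1 : e < 1) (he2 : e < 2^-1) :
  extreme_points (ball_G01 e) =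
  [set u : Linf01 R | exists a b sigma : R,
     [/\ a \in `[e, 1 - e], b \in `[e, 1 - e], a < b,
         (sigma = -1 \/ sigma = 1) &
         u = (sigma * 2^-1) *: Linf01_indic a b]].
Proof.
apply/seteqP; split=> [u|u [a [b [sigma [aI bI ab sg uE]]]]].
  exact: extreme_is_half_indic.
exact: (half_indic_extreme he0 he2 aI bI ab sg uE).
Qed.
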